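(* If $G$ is a finite simple connected graph with at least two vertices, then $o(G\circ P_4)=\mathcal{R}$ and $R_{\rm MB}(G\circ P_4)=R_{\rm MB}'(G\circ P_4)=2n(G)$.
   Context: $P_n$ is the path on $n$ vertices; $n(G)$ is the number of vertices of $G$. The lexicographic product $G\circ H$ has vertex set $V(G)\times V(H)$, with $(g,h)(g',h')$ an edge iff $gg'\in E(G)$, or $g=g'$ and $hh'\in E(H)$. A set $W\subseteq V(X)$ is a resolving set of a connected graph $X$ if for every two distinct vertices $x,y$ there is $z\in W$ with $d(x,z)\ne d(y,z)$. In the Maker-Breaker resolving game on $X$, Resolver and Spoiler alternately select unplayed vertices of $X$; Resolver wins if the vertices he selects contain a resolving set of $X$, and Spoiler wins if she selects at least one vertex of every resolving set of $X$. The R-game has Resolver moving first; the S-game has Spoiler moving first. $o(X)=\mathcal{R}$ means Resolver has a winning strategy no matter who starts. $R_{\rm MB}(X)$ (resp. $R_{\rm MB}'(X)$) is the minimum number of moves Resolver needs to win the R-game (resp. S-game) under optimal play of both players. *)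

(* Defs.v *)
From mathcomp Require Import all_boot.

Set Implicit Arguments.
Unset Strict Implicit.
Unset Printing Implicit Defensive.

(** A finite simple graph is a symmetric irreflexive relation on a finType. *)

Definition connected_graph (T : finType) (e : rel T) : Prop :=
  forall x y : T, connect e x y.

Definition path_graph (n : nat) : rel 'I_n :=
  fun i j => (i.+1 == j :> nat) || (j.+1 == i :> nat).

Definition lex_product (T U : finType) (e : rel T) (f : rel U) : rel (T * U) :=
  fun x y => e x.1 y.1 || ((x.1 == y.1) && f x.2 y.2).

Definition walk (T : finType) (e : rel T) (n : nat) (x y : T) : bool :=
  [exists p : n.-tuple T, path e x p && (last x p == y)].

(** The least length of a walk from [x] to [y]. In a graph on [#|T|] vertices
    a shortest walk has length less than [#|T|]; the value is [#|T|] when [x]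
    and [y] are not connected. *)
Definition gdist (T : finType) (e : rel T) (x y : T) : nat :=
  find (fun n => walk e n x y) (iota 0 #|T|).

Definition resolving_set (T : finType) (e : rel T) (W : {set T}) : Prop :=
  forall x y : T, x <> y -> exists2 z, z \in W & gdist e x z <> gdist e y z.

(** * The Maker-Breaker resolving game

    Plays are continued until every vertex is selected. This does not affect
    who wins: once Resolver's vertices contain a resolving set (or Spoiler's
    meet every resolving set) later moves cannot undo it, and on a full board
    exactly one of the two holds. *)

Variant player := Resolver | Spoiler.

(** Move number [i], counted from 0, belongs to Resolver. *)
Definition resolver_turn (first : player) (i : nat) : bool :=
  if first is Resolver then ~~ odd i else odd i.

Definition complete_play (T : finType) (s : seq T) : Prop :=
  uniq s /\ size s = #|T|.

(** The vertices selected by Resolver, in the order in which he plays them. *)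
Definition resolver_moves (T : finType) (first : player) (s : seq T) : seq T :=
  mask (mkseq (resolver_turn first) (size s)) s.

(** A strategy maps the sequence of vertices selected so far, by both players,
    to the next vertex to select. *)
Definition strategy (T : finType) : Type := seq T -> T.

Definition legal_strategy (T : finType) (sigma : strategy T) : Prop :=
  forall h : seq T, uniq h -> size h < #|T| -> sigma h \notin h.

Definition follows (T : finType) (first : player) (sigma : strategy T)
    (s : seq T) : Prop :=
  forall (h : seq T) (x : T) (t : seq T),
    s = h ++ x :: t -> resolver_turn first (size h) -> x = sigma h.

Definition contains_resolving_set (T : finType) (e : rel T) (s : seq T) : Prop :=
  exists2 W : {set T}, W \subset s & resolving_set e W.

Definition winning_strategy (T : finType) (e : rel T) (first : player)
    (sigma : strategy T) : Prop :=
  legal_strategy sigma /\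
  forall s : seq T, complete_play s -> follows first sigma s ->
    contains_resolving_set e (resolver_moves first s).

(** [sigma] guarantees a win after at most [k] moves of Resolver. *)
Definition winning_strategy_within (T : finType) (e : rel T) (first : player)
    (k : nat) (sigma : strategy T) : Prop :=
  legal_strategy sigma /\
  forall s : seq T, complete_play s -> follows first sigma s ->
    contains_resolving_set e (take k (resolver_moves first s)).

Definition outcome_R (T : finType) (e : rel T) : Prop :=
  forall first : player, exists sigma, winning_strategy e first sigma.

(** [k] is the least number of moves within which Resolver can force a win in
    the game started by [first]. There is no such [k] if he cannot win. *)
Definition min_resolver_moves (T : finType) (e : rel T) (first : player)
    (k : nat) : Prop :=
  (exists sigma, winning_strategy_within e first k sigma) /\
  forall j : nat, (exists sigma, winning_strategy_within e first j sigma) ->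
    k <= j.

(** [R_MB e k] reads "R_MB(X) = k" and [R_MB' e k] reads "R_MB'(X) = k". *)
Definition R_MB (T : finType) (e : rel T) (k : nat) : Prop :=
  min_resolver_moves e Resolver k.

Definition R_MB' (T : finType) (e : rel T) (k : nat) : Prop :=
  min_resolver_moves e Spoiler k.

(* Main.v *)
Require Import Defs.
From mathcomp Require Import all_boot zify.

Set Implicit Arguments.
Unset Strict Implicit.
Unset Printing Implicit Defensive.

(** Vertices of one copy of [P_4] have equal distances to every vertex outside
    the copy, and inside the copy all distances are 0, 1 or 2. No single vertex
    of [P_4] separates all others at this truncated distance, so a resolving
    set has at least two vertices in each copy: [2 n(G)] is a lower bound.

    Resolver's strategy is a pairing strategy with two pairs in each copy. As
    each pair of vertices of [P_4] is separated by at least three of the four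
    vertices, any pairing separates vertices of the same copy. Copies of [g]
    and [g'] can only be confused if [g] and [g'] are twins. The pairing
    {0,2}, {1,3} (non-adjacent mates) handles true twins, {0,1}, {2,3}
    (adjacent mates) handles false twins, and no vertex has twins of both
    kinds. The board has [4 n(G)] vertices, so Resolver makes [2 n(G)] moves
    in a complete play. *)

(** * Distances truncated at 2 *)

Section Distance.
Variables (T : finType) (e : rel T).
Implicit Types x y z : T.

Lemma walkP n x y :
  reflect (exists p : seq T, [/\ size p = n, path e x p & last x p = y])
          (walk e n x y).
Proof.
apply: (iffP existsP) => [[p /andP[xp /eqP <-]]|[p [sp xp <-]]].
  by exists p; rewrite size_tuple.
by move/eqP: sp => sp; exists (Tuple sp); rewrite xp eqxx.
Qed.

Lemma gdist_max x y : gdist e x y <= #|T|.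
Proof. by rewrite -[X in _ <= X](size_iota 0) find_size. Qed.

Lemma gdist_le n x y : walk e n x y -> gdist e x y <= n.
Proof.
move=> wn; have [ltn|] := ltnP n #|T|; last exact/leq_trans/gdist_max.
rewrite leqNgt; apply/negP => /(before_find 0).
by rewrite nth_iota // add0n wn.
Qed.

Lemma walk_gdist x y : gdist e x y < #|T| -> walk e (gdist e x y) x y.
Proof.
move=> lt; have hs : has (fun n => walk e n x y) (iota 0 #|T|).
  by rewrite has_find size_iota.
by have := nth_find 0 hs; rewrite nth_iota.
Qed.

Lemma walk0 x y : walk e 0 x y = (x == y).
Proof.
apply/walkP/eqP => [[p [/size0nil -> _ <-]]//|->].
by exists [::].
Qed.

Lemma walk1 x y : walk e 1 x y = e x y.
Proof.
apply/walkP/idP => [[[|a [|b p]] [] //= _ /andP[xa _] <- //]|xy].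
by exists [:: y]; rewrite /= xy.
Qed.

(** Distance cut off at 2, which adjacency alone determines. Vertices that it tells apart also
    differ in [gdist]. *)
Definition dist2 x y : nat := if x == y then 0 else if e x y then 1 else 2.

Lemma minn_gdist2 x y : 1 < #|T| -> minn (gdist e x y) 2 = dist2 x y.
Proof.
move=> T1; rewrite /dist2; case: eqP => [->|nxy].
  by have := @gdist_le 0 y y; rewrite walk0 eqxx => /(_ isT); lia.
have n0 : gdist e x y != 0.
  apply/eqP => g0; have := @walk_gdist x y; rewrite g0 walk0 => W.
  by apply: nxy; apply/eqP/W; lia.
case: ifPn => xy.
  by have := @gdist_le 1 x y; rewrite walk1 => /(_ xy); lia.
(* [T1] makes 1 a genuine walk length rather than the default value [#|T|]. *)
have n1 : gdist e x y != 1.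
  apply/eqP => g1; have := @walk_gdist x y; rewrite g1 walk1 (negbTE xy) => W.
  by have := W T1.
by lia.
Qed.

Lemma gdist_neq x y z : 1 < #|T| ->
  dist2 x z != dist2 y z -> gdist e x z <> gdist e y z.
Proof. by move=> T1; rewrite -!minn_gdist2 // => /eqP h E; apply: h; rewrite E. Qed.

End Distance.

(** * Plays and pairing strategies *)

Section Strategies.
Variables (T : finType) (first : player).
Implicit Types (x y : T) (s h : seq T) (sigma : strategy T).

Lemma mem_resolver_moves s x : uniq s ->
  (x \in resolver_moves first s) = (x \in s) && resolver_turn first (index x s).
Proof.
move=> us; rewrite in_mask //; case xs: (x \in s) => //=.
by rewrite nth_mkseq // index_mem.
Qed.

Lemma resolver_turnS i :
  resolver_turn first i.+1 = ~~ resolver_turn first i.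
Proof. by case: first => /=. Qed.

Lemma size_resolver_moves s n : size s = n.*2 ->
  size (resolver_moves first s) = n.
Proof.
move=> ss; rewrite size_mask ?size_mkseq // ss /mkseq count_map.
elim: {s ss} n => // n IH.
(* Exactly one of the last two positions belongs to Resolver. *)
rewrite doubleS -addn2 iotaD count_cat [X in X + _]IH add0n /= !resolver_turnS.
by case: resolver_turn; lia.
Qed.

(** Let [sigma] choose the moves of both players. The lower bound needs one such play to test a
    strategy on. *)
Lemma exists_play_following sigma : legal_strategy sigma ->
  exists2 s, complete_play s & follows first sigma s.
Proof.
move=> leg; suff /(_ #|T| (leqnn _)) [s [us ss fs]] : forall n, n <= #|T| ->
    exists s, [/\ uniq s, size s = n & follows first sigma s].
  by exists s.
elim=> [_|n IH lt]; first by exists [::]; split=> // [[|a h]] ? ?.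
have [s [us ss fs]] := IH (ltnW lt).
exists (rcons s (sigma s)); split.
- by rewrite rcons_uniq us leg // ss.
- by rewrite size_rcons ss.
move=> h x t; case/lastP: t => [|t z].
  by rewrite cats1 => /rcons_inj[-> ->].
by rewrite -rcons_cons -rcons_cat => /rcons_inj[E _]; apply: fs E.
Qed.

Variables (mate : T -> T) (x0 : T).

(** When Resolver is to move, the last entry of [h] is Spoiler's latest move. On the empty board
    [x0] stands in for it, so the opening move is [mate x0]. *)
Definition pairing_strategy : strategy T := fun h =>
  let y := mate (last x0 h) in
  if y \notin h then y else odflt x0 [pick x | x \notin h].

Lemma pairing_strategy_legal : legal_strategy pairing_strategy.
Proof.
move=> h uh sh; rewrite /pairing_strategy; case: ifP => //= _.
case: pickP => //= all_h; move: sh; rewrite -(card_uniqP uh) ltnNge => /negP[].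
by apply/subset_leq_card/subsetP => x _; have /negbFE := all_h x.
Qed.

Hypotheses (mateK : involutive mate) (mate_neq : forall x, mate x != x).

(* If Spoiler is the first to enter a pair, Resolver answers with the mate. *)
Lemma pairing_strategy_hits s x :
  complete_play s -> follows first pairing_strategy s ->
  (x \in resolver_moves first s) || (mate x \in resolver_moves first s).
Proof.
move=> [us ss] fs.
have ins y : y \in s.
  have /subset_cardP : #|s| = #|T| by rewrite (card_uniqP us).
  by move/(_ (subset_predT _)) => ->.
rewrite !mem_resolver_moves // !ins /=.
wlog lt : x / index x s < index (mate x) s.
  move=> W; have [|gt|E] := ltngtP (index x s) (index (mate x) s).
  - exact: W.
  - by have := W (mate x); rewrite mateK orbC; apply.
  - have := mate_neq x.
    by rewrite -[mate x](nth_index x0 (ins _)) -E nth_index // eqxx.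
set i := index x s in lt *; apply/orP.
case Ri: (resolver_turn first i); [by left | right].
have is_ : i < size s by rewrite index_mem.
(* Spoiler took [x] at move [i] and [mate x] comes later, so move [i.+1] exists. It is Resolver's,
   and [mate x] is still free then. *)
have i1s : i.+1 < size s by apply: leq_ltn_trans lt _; rewrite index_mem.
have Ri1 : resolver_turn first i.+1 by rewrite resolver_turnS Ri.
have E : s = take i.+1 s ++ nth x0 s i.+1 :: drop i.+2 s.
  by rewrite -drop_nth // cat_take_drop.
have := fs _ _ _ E; rewrite size_take i1s => /(_ Ri1).
have nmx : mate x \notin take i.+1 s.
  apply/negP => mx.
  by have := index_ltn mx; lia.
rewrite /pairing_strategy.
have -> : last x0 (take i.+1 s) = x by rewrite (take_nth x0) // last_rcons nth_index.
by rewrite nmx => <-; rewrite index_uniq.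
Qed.

End Strategies.

Lemma contains_resolving_setW (T : finType) (e : rel T) (s t : seq T) :
  {subset s <= t} -> contains_resolving_set e s -> contains_resolving_set e t.
Proof.
move=> st [W Ws rW]; exists W => //.
by apply/subsetP => x /(subsetP Ws) /st.
Qed.

(** * Pairings and separation in the path on four vertices *)

Notation P4 := (@path_graph 4).

(* Adjacent mates {0,1}, {2,3} for [b = false]; non-adjacent mates {0,2}, {1,3}
   for [b = true]. *)
Definition P4_mate (b : bool) (h : 'I_4) : 'I_4 :=
  inord (nth 0 (if b then [:: 2; 3; 0; 1] else [:: 1; 0; 3; 2]) h).

Lemma val_P4_mate b h : P4_mate b h =
  nth 0 (if b then [:: 2; 3; 0; 1] else [:: 1; 0; 3; 2]) h :> nat.
Proof. by apply: inordK; case: b h => [] [[|[|[|[|//]]]] ?]. Qed.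

Lemma P4_mateK b : involutive (P4_mate b).
Proof.
move=> h; apply: val_inj => /=; rewrite !val_P4_mate.
by case: b h => [] [[|[|[|[|//]]]] ?].
Qed.

Lemma P4_mate_neq b h : P4_mate b h != h.
Proof.
rewrite -val_eqE /= val_P4_mate.
by case: b h => [] [[|[|[|[|//]]]] ?].
Qed.

Lemma path_graph_mate b h : P4 h (P4_mate b h) = ~~ b.
Proof. by rewrite /path_graph val_P4_mate; case: b h => [] [[|[|[|[|//]]]] ?]. Qed.

Lemma P4_mates_separate b (h h' : 'I_4) : h != h' ->
  exists k, dist2 P4 h k != dist2 P4 h' k
         /\ dist2 P4 h (P4_mate b k) != dist2 P4 h' (P4_mate b k).
Proof.
have E k : dist2 P4 h k != dist2 P4 h' k = ((if h == k :> nat then 0 else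
    if (h.+1 == k) || (k.+1 == h) then 1 else 2) !=
    (if h' == k :> nat then 0 else if (h'.+1 == k) || (k.+1 == h') then 1 else 2)).
  by [].
move=> nh; suff [k] : exists k : 'I_4, (dist2 P4 h k != dist2 P4 h' k)
    && (dist2 P4 h (P4_mate b k) != dist2 P4 h' (P4_mate b k)).
  by case/andP; exists k.
move: nh; rewrite -val_eqE.
(* One representative per pair: [k0], [k2] for [b = false] and [k0], [k1] for [b = true]. At most
   one vertex fails to separate [h] and [h'], and the pair avoiding it serves. *)
pose k0 := @Ordinal 4 0 isT; pose k1 := @Ordinal 4 1 isT.
pose k2 := @Ordinal 4 2 isT.
by case: b h h' E => [] [[|[|[|[|//]]]] ?] [[|[|[|[|//]]]] ?] // E _;
  solve [ by exists k0; rewrite !E !val_P4_mate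
        | by exists k1; rewrite !E !val_P4_mate
        | by exists k2; rewrite !E !val_P4_mate ].
Qed.

(** An inner vertex does not separate its two neighbours; an end does not separate the two vertices
    beyond its neighbour, both at truncated distance 2. *)
Lemma P4_singleton_not_separating (k : 'I_4) :
  exists h h', h != h' /\ dist2 P4 h k = dist2 P4 h' k.
Proof.
pose k0 := @Ordinal 4 0 isT; pose k1 := @Ordinal 4 1 isT.
pose k2 := @Ordinal 4 2 isT; pose k3 := @Ordinal 4 3 isT.
by case: k => [[|[|[|[|//]]]] ?];
  [exists k2, k3 | exists k0, k2 | exists k1, k3 | exists k0, k1].
Qed.

(** * Resolving sets of the lexicographic product and the game on it *)

Section LexProductP4.
Variables (G : finType) (e : rel G).
Hypotheses (e_sym : symmetric e) (e_irr : irreflexive e).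
Hypotheses (e_conn : connected_graph e) (G_gt1 : 1 < #|G|).

Let L := lex_product e P4.
Implicit Types (g : G) (h k : 'I_4).

Lemma card_lex_P4 : #|{: G * 'I_4}| = (2 * #|G|).*2.
Proof. by rewrite card_prod card_ord; lia. Qed.

Lemma dist2_lex g h g' k : dist2 L (g, h) (g', k) =
  if g == g' then dist2 P4 h k else if e g g' then 1 else 2.
Proof.
rewrite /dist2 /L /lex_product xpair_eqE /=.
by case: eqP => [<-|_] /=; rewrite ?e_irr ?orbF.
Qed.

(** The first vertex of a walk outside the copy of [g] is adjacent to the whole copy. Dropping the
    steps before it and changing the start gives a walk that is no longer. *)
Lemma gdist_lex_other_copy g h h' g' k : g != g' ->
  gdist L (g, h) (g', k) = gdist L (g, h') (g', k).
Proof.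
suff le a b : g != g' -> gdist L (g, a) (g', k) <= gdist L (g, b) (g', k).
  by move=> ne; apply/eqP; rewrite eqn_leq !le.
move=> ne; have [lt|] := ltnP (gdist L (g, b) (g', k)) #|{: G * 'I_4}|; last first.
  exact: leq_trans (gdist_max _ _ _).
have /walkP[p [<- + +]] := walk_gdist lt; elim: p b {lt} => [|[v i] p IH] b /=.
  by move=> _ [E]; rewrite E eqxx in ne.
case/andP=> bv vp lp; have [E|nE] := eqVneq v g.
  by rewrite E in vp lp; apply: leq_trans (IH _ vp lp) _.
apply: gdist_le; apply/walkP; exists ((v, i) :: p); split=> //=.
by move: bv; rewrite vp /L /lex_product /= eq_sym (negbTE nE) /= orbF => ->.
Qed.

Lemma exists_neighbor g : exists g', e g g'.
Proof.
have [g' ne] : exists g', g' != g.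
  by have /card_gt1P[x [y [_ _]]] := G_gt1; case: (eqVneq x g) => [->|];
    [rewrite eq_sym; exists y | exists x].
have /connectP[[|a p] /= + E] := e_conn g g'; first by rewrite E eqxx in ne.
by case/andP=> ga _; exists a.
Qed.

(** A detour through a neighbouring copy takes two steps, so truncation at 2 loses nothing inside a
    copy. *)
Lemma gdist_lex_same_copy g h k : gdist L (g, h) (g, k) = dist2 P4 h k.
Proof.
have le2 : gdist L (g, h) (g, k) <= 2.
  apply: gdist_le; apply/walkP; have [g' gg'] := exists_neighbor g.
  exists [:: (g', h); (g, k)]; split=> //=.
  by rewrite /L /lex_product /= gg' e_sym gg'.
have := @minn_gdist2 _ L (g, h) (g, k); rewrite dist2_lex eqxx card_lex_P4.
by move=> <-; lia.
Qed.

Lemma resolving_two_per_copy (W : {set G * 'I_4}) g :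
  resolving_set L W -> 1 < #|[set x in W | x.1 == g]|.
Proof.
move=> rW; rewrite ltnNge; apply/negP => le1.
have [k Wk] : exists k, forall h, (g, h) \in W -> h = k.
  case: (pickP [pred h | (g, h) \in W]) => [k /= gk|none].
    exists k => h gh; have /card_le1_eqP/(_ (g, h) (g, k)) := le1.
    by rewrite !inE gh gk eqxx => /(_ isT isT) [].
  (* If [W] misses the copy, any [k] will do. *)
  by exists ord0 => h gh; have := none h; rewrite /= gh.
have [h [h' [ne E]]] := P4_singleton_not_separating k.
have [|[g' l] zW] := rW (g, h) (g, h').
  by case=> hh; rewrite hh eqxx in ne.
have [gg'|gg'] := eqVneq g g'; last by rewrite (gdist_lex_other_copy h h').
by rewrite -gg' in zW *; rewrite (Wk _ zW) !gdist_lex_same_copy.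
Qed.

Lemma resolving_card_ge (W : {set G * 'I_4}) :
  resolving_set L W -> 2 * #|G| <= #|W|.
Proof.
move=> rW; rewrite -[X in _ <= X]sum1_card (partition_big fst xpredT) //=.
rewrite mulnC -sum_nat_const; apply: leq_sum => g _.
rewrite sum1dep_card; apply: leq_trans (resolving_two_per_copy g rW) _.
by apply: subset_leq_card; apply/subsetP => x; rewrite !inE.
Qed.

Definition has_true_twin g : bool :=
  [exists a, e g a && [forall x, (x != g) ==> (x != a) ==> (e g x == e a x)]].

Definition lex_mate (x : G * 'I_4) : G * 'I_4 :=
  (x.1, P4_mate (has_true_twin x.1) x.2).

Lemma lex_mateK : involutive lex_mate.
Proof. by case=> g h; rewrite /lex_mate /= P4_mateK. Qed.

Lemma lex_mate_neq x : lex_mate x != x.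
Proof.
by case: x => g h; rewrite /lex_mate xpair_eqE eqxx (negbTE (P4_mate_neq _ _)).
Qed.

(** Suppose [g] has a true twin [a] other than [g']. Being adjacent to [g], [a] is adjacent to its
    twin [g']; hence so is [g], the twin of [a]. *)
Lemma twins_adjacency g g' : g != g' ->
  (forall x, x != g -> x != g' -> e g x = e g' x) -> has_true_twin g = e g g'.
Proof.
move=> ne tw; apply/existsP/idP => [[a /andP[ga /forallP ta]]|gg'].
  have [<- //|ag'] := eqVneq a g'.
  have ag : a != g by apply/eqP => E; rewrite E e_irr in ga.
  have := ta g'; rewrite eq_sym ne eq_sym ag' /= => /eqP ->.
  by rewrite e_sym -tw.
exists g'; rewrite gg'; apply/forallP => x.
by apply/implyP => xg; apply/implyP => xg'; rewrite tw.
Qed.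

Lemma pairing_transversal_resolving (W : {set G * 'I_4}) :
  (forall x, (x \in W) || (lex_mate x \in W)) -> resolving_set L W.
Proof.
move=> hit [g h] [g' h'] ne.
suff [z zW d] : exists2 z, z \in W & dist2 L (g, h) z != dist2 L (g', h') z.
  by exists z => //; apply: gdist_neq d; rewrite card_lex_P4; lia.
have [gg'|gg'] := eqVneq g g'.
  rewrite -gg' in ne *.
  have nh : h != h' by apply/eqP => E; apply: ne; rewrite E.
  have [k [sk smk]] := P4_mates_separate (has_true_twin g) nh.
  case/orP: (hit (g, k)) => [kW|mW]; first by exists (g, k); rewrite ?dist2_lex ?eqxx.
  by exists (lex_mate (g, k)); rewrite ?dist2_lex ?eqxx.
(* If some other [x] is adjacent to just one of [g] and [g'], every vertex of its copy separates,
   and [W] meets that copy. *)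
case: (pickP [pred x | [&& x != g, x != g' & e g x != e g' x]]).
  move=> x /= /and3P[xg xg' exx].
  have [k kW] : exists k, (x, k) \in W.
    case/orP: (hit (x, ord0)) => ?; first by exists ord0.
    by exists (lex_mate (x, ord0)).2.
  exists (x, k) => //; rewrite !dist2_lex ![_ == x]eq_sym (negbTE xg) (negbTE xg').
  by move: exx; case: (e g x); case: (e g' x).
move=> none; have tw : has_true_twin g = e g g'.
  apply: twins_adjacency => // x xg xg'.
  by have := none x; rewrite /= xg xg' => /negbFE/eqP.
(* For twins, the whole copy of [g] is at one truncated distance, 1 or 2, from [(g', h')]. From
   [(g, h)], the vertex itself is at 0, and its mate is at 2 if [e g g'] and at 1 otherwise, so
   either one separates. *)
have [k kW dk] : exists2 k, (g, k) \in W & dist2 P4 h k != if e g g' then 1 else 2.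
  case/orP: (hit (g, h)) => [hW|mW]; [exists h => // | exists (lex_mate (g, h)).2 => //].
    by rewrite /dist2 eqxx; case: ifP.
  rewrite /dist2 /= (eq_sym h) (negbTE (P4_mate_neq _ _)) path_graph_mate tw.
  by case: (e g g').
exists (g, k) => //.
by rewrite !dist2_lex eqxx (eq_sym g') (negbTE gg') (e_sym g').
Qed.

Lemma pairing_strategy_wins first x0 :
  winning_strategy_within L first (2 * #|G|) (pairing_strategy lex_mate x0).
Proof.
split=> [|s cs fs]; first exact: pairing_strategy_legal.
rewrite take_oversize; last first.
  by rewrite (@size_resolver_moves _ _ _ (2 * #|G|)) // cs.2 card_lex_P4.
exists [set x in resolver_moves first s]; first by apply/subsetP => x; rewrite inE.
apply: pairing_transversal_resolving => x; rewrite !inE.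
exact: pairing_strategy_hits lex_mateK lex_mate_neq _ _ cs fs.
Qed.

Lemma winning_strategy_within_ge first j sigma :
  winning_strategy_within L first j sigma -> 2 * #|G| <= j.
Proof.
case=> leg win; have [s cs fs] := exists_play_following first leg.
have [W Ws rW] := win s cs fs.
apply: leq_trans (resolving_card_ge rW) _.
apply: leq_trans (subset_leq_card Ws) _.
by apply: leq_trans (card_size _) _; rewrite size_take; case: ltnP.
Qed.

End LexProductP4.

Theorem theorem5p2 (G : finType) (e : rel G) (e_sym : symmetric e)
    (e_irr : irreflexive e) (e_conn : connected_graph e) (G_gt1 : 1 < #|G|) :
  [/\ outcome_R (lex_product e (@path_graph 4)),
      R_MB (lex_product e (@path_graph 4)) (2 * #|G|)
    & R_MB' (lex_product e (@path_graph 4)) (2 * #|G|)].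
Proof.
have /card_gt0P[g _] : 0 < #|G| by apply: ltnW.
have win first := pairing_strategy_wins e_sym e_irr G_gt1 first (g, ord0).
have min first : min_resolver_moves (lex_product e P4) first (2 * #|G|).
  split=> [|j [sigma]]; first by eexists; exact: win.
  exact: winning_strategy_within_ge.
split=> [first||]; [|exact: min|exact: min].
have [leg W] := win first; eexists; split; first exact: leg.
move=> s cs fs; apply: contains_resolving_setW (W s cs fs).
exact: mem_take.
Qed.
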